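(* Let $D\in\mathbb{N}$, let $U=\mathcal{T}_D$, let $L$ be a relative involutive division on $U$, and let $N\subseteq U$. Then $$H:=\Bigl(\bigcup_{l\in N}C_L(l,U)\Bigr)\cup\{v\in\mathcal{T} : \deg(v)<D\}$$ is an order ideal if and only if $N$ is revenant.
   Context: $\mathcal{T}$ is the set (monoid) of all terms (monic monomials) $x_1^{\gamma_1}\cdots x_n^{\gamma_n}$ in the variables $x_1,\dots,x_n$, and $\mathcal{T}_D$ is the set of terms of degree $D$. A subset of $\mathcal{T}$ is an order ideal if it contains every divisor of each of its elements. A relative involutive division $L$ on a finite set $U\subset\mathcal{T}$ is the assignment, to each $u\in U$, of a partition $\{x_1,\dots,x_n\}=M_L(u,U)\sqcup NM_L(u,U)$ of the variables into multiplicative and non-multiplicative ones such that, setting $L(u,U)=\{x_1^{a_1}\cdots x_n^{a_n} : a_i\ne 0\Rightarrow x_i\in M_L(u,U)\}$ and $C_L(u,U)=uL(u,U)=\{uw: w\in L(u,U)\}$ (the cone of $u$): (1) the semigroup ideal $\{\tau u:\tau\in\mathcal{T},u\in U\}$ generated by $U$ equals $\bigcup_{u\in U}C_L(u,U)$; (2) $C_L(u,U)\cap C_L(v,U)=\emptyset$ for all distinct $u,v\in U$. For $s,t\in U$, $X(s,t)$ denotes the unique element of $U$ with $\operatorname{lcm}(s,t)\in C_L(X(s,t),U)$. A set $N\subseteq U$ is called revenant if for all $t,s\in U$: $X(t,s)=t$ and $t\in N$ imply $s\in N$. *)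

(* Defs.v *)
From mathcomp Require Import all_boot.
From mathcomp Require Import finmap.
From mathcomp Require Import mpoly.

Set Implicit Arguments.
Unset Strict Implicit.
Unset Printing Implicit Defensive.

Local Open Scope fset_scope.

(* Terms in n variables are the multinomials 'X_{1..n}, written additively:
   multiplication of terms is (v + w)%MM, divisibility is (v <= w)%MM and the
   lcm is mlcm. A finite set of terms U : {fset 'X_{1..n}} is also used as the
   finite type of its elements, so that {set U} is the type of subsets of U. *)

Definition terms_deg (n D : nat) : {fset 'X_{1..n}} :=
  [fset bmnm m | m : 'X_{1..n < D.+1} & mdeg m == D].

Lemma in_terms_deg n D (v : 'X_{1..n}) : (v \in terms_deg n D) = (mdeg v == D).
Proof.
apply/imfsetP/idP => [[m /= + ->] //|vD].
have vlt : mdeg v < D.+1 by rewrite (eqP vD).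
by exists (BMultinom vlt).
Qed.

Definition order_ideal n (S : {pred 'X_{1..n}}) : Prop :=
  forall v w : 'X_{1..n}, v \in S -> (w <= v)%MM -> w \in S.

Definition semigroup_ideal n (U : {fset 'X_{1..n}}) (v : 'X_{1..n}) : Prop :=
  exists (tau : 'X_{1..n}) (u : U), v = (tau + val u)%MM.

Section Cone.
Variables (n : nat) (U : {fset 'X_{1..n}}) (M : U -> {set 'I_n}).

Definition mult_terms (u : U) : {pred 'X_{1..n}} :=
  [pred w : 'X_{1..n} | [forall i, (w i != 0) ==> (i \in M u)]].

(* Since (v - val u)%MM is truncated, the divisibility test is needed; coneP
   gives the description as the set of multiples of u by mult_terms u. *)
Definition cone (u : U) : {pred 'X_{1..n}} :=
  [pred v : 'X_{1..n} | (val u <= v)%MM & (v - val u)%MM \in mult_terms u].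

Lemma coneP (u : U) (v : 'X_{1..n}) :
  reflect (exists2 w, w \in mult_terms u & v = (val u + w)%MM) (v \in cone u).
Proof.
apply: (iffP andP) => [[le_uv wM]|[w wM ->]].
  by exists (v - val u)%MM => //; rewrite addmC submK.
by rewrite lem_addr // addmC addmK.
Qed.

End Cone.

(* The non-multiplicative variables of u are the complement of mult_vars u, so the
   partition of the variables is carried by mult_vars alone. *)
Record rel_inv_div n (U : {fset 'X_{1..n}}) := RelInvDiv {
  mult_vars :> U -> {set 'I_n};
  cones_cover : forall v : 'X_{1..n},
    semigroup_ideal U v <-> exists u : U, v \in cone mult_vars u;
  cones_disjoint : forall u v : U, u != v ->
    forall w : 'X_{1..n}, ~ (w \in cone mult_vars u /\ w \in cone mult_vars v)
}.

Section Revenant.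
Variables (n : nat) (U : {fset 'X_{1..n}}) (L : rel_inv_div U).

Lemma lcm_in_cone (s t : U) :
  exists x : U, mlcm (val s) (val t) \in cone L x.
Proof.
apply/(cones_cover L); exists (mlcm (val s) (val t) - val s)%MM, s.
by rewrite submK ?lem_mlcml.
Qed.

Definition lcm_cone (s t : U) : U := xchoose (lcm_in_cone s t).

Lemma lcm_coneP (s t x : U) :
  mlcm (val s) (val t) \in cone L x <-> lcm_cone s t = x.
Proof.
have cX : mlcm (val s) (val t) \in cone L (lcm_cone s t).
  exact: (xchooseP (lcm_in_cone s t)).
split=> [cx|<- //]; apply/eqP; apply: contraT => ne.
by case: (cones_disjoint ne (conj cX cx)).
Qed.

Definition revenant (N : {set U}) : Prop :=
  forall t s : U, lcm_cone t s = t -> t \in N -> s \in N.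

End Revenant.

(* Main.v *)
Require Import Defs.
From mathcomp Require Import all_boot.
From mathcomp Require Import finmap.
From mathcomp Require Import mpoly.

(** Cones are convex for divisibility: a term lying between u and a member of
    the cone of u lies in that cone ([cone_between]).  Hence if l and u both
    divide a term v of the cone of l, then lcm(l, u), which lies between l and
    v, is in the cone of l too, that is, X(l, u) = l.

    So let N be revenant, v in the cone of some l in N, and w a divisor of v
    of degree at least D.  As all terms of degree D belong to U, w is a
    multiple of one of them ([lem_deg_exists]), so w is in the cone of some u
    in U by covering; both l and u divide v, hence X(l, u) = l and u is in N.

    Conversely, if X(t, s) = t with t in N, then s divides lcm(t, s), which is
    in the cone of t; thus s is in the order ideal.  Having degree exactly D, s
    belongs to no cone but its own ([cone_mdeg_eq]), so s is in N. *)

Section Cones.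
Context {n : nat}.
Implicit Types (U : {fset 'X_{1..n}}) (v w : 'X_{1..n}).

Lemma cone_lem {U} {M : U -> {set 'I_n}} {u : U} {v} :
  v \in cone M u -> (val u <= v)%MM.
Proof. by case/andP. Qed.

(** The quotient of w by u divides that of v by u, so it involves no variable
    that the latter does not involve. *)
Lemma cone_between {U} {M : U -> {set 'I_n}} {u : U} {v w} :
  v \in cone M u -> (val u <= w)%MM -> (w <= v)%MM -> w \in cone M u.
Proof.
case/andP=> _ /forallP /= multM le_uw /mnm_lepP le_wv.
rewrite inE le_uw; apply/forallP=> i; apply/implyP=> nz_i.
apply: (implyP (multM i)); rewrite !mnmBE -!lt0n in nz_i *.
exact: leq_trans nz_i (leq_sub2r _ (le_wv i)).
Qed.

Lemma cone_mdeg_eq {U} {M : U -> {set 'I_n}} {u : U} {v} :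
  v \in cone M u -> mdeg (val u) = mdeg v -> v = val u.
Proof.
move/cone_lem=> le_uv eq_deg.
have: mdeg (v - val u)%MM == 0.
  by rewrite -(eqn_add2r (mdeg (val u))) -mdegD submK // eq_deg.
by rewrite mdeg_eq0 => /eqP quo1; rewrite -(submK le_uv) quo1 add0m.
Qed.

Lemma lem_deg_exists {D v} :
  D <= mdeg v -> exists2 u : 'X_{1..n}, (u <= v)%MM & mdeg u = D.
Proof.
elim: D => [|D IHD] ltDv.
  by exists 0%MM; [apply/mnm_lepP=> i; rewrite mnm0E | exact: mdeg0].
have [u le_uv degu] := IHD (ltnW ltDv).
(* Some variable has room left: otherwise v would divide u, of smaller degree. *)
have [i lt_i]: exists i, u i < v i.
  apply/existsP; apply: contraLR ltDv => /existsPn ge_uv.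
  rewrite -leqNgt -degu !mdegE; apply: leq_sum => i _.
  by rewrite leqNgt ge_uv.
exists (u + U_(i))%MM; last by rewrite mdegD mdeg1 degu addn1.
apply/mnm_lepP=> j; rewrite mnmDE mnm1E.
by case: eqP => [<-|_]; rewrite ?addn1 ?addn0 //; exact/mnm_lepP.
Qed.

End Cones.

Section FullDegree.
Context {n D : nat}.
Implicit Types (L : rel_inv_div (terms_deg n D)) (v : 'X_{1..n}).

Lemma mdeg_terms_deg (u : terms_deg n D) : mdeg (val u) = D.
Proof. by apply/eqP; rewrite -in_terms_deg; exact: valP. Qed.

Lemma cone_deg_ge L {v} : D <= mdeg v -> exists u, v \in cone L u.
Proof.
case/lem_deg_exists=> u le_uv /eqP; rewrite -in_terms_deg => uU.
by apply/(cones_cover L); exists (v - u)%MM, [` uU]%fset; rewrite submK.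
Qed.

End FullDegree.

Theorem proposition40 (n D : nat) (L : rel_inv_div (terms_deg n D))
    (N : {set terms_deg n D}) :
  order_ideal [pred v : 'X_{1..n} |
                 [exists l in N, v \in cone L l] || (mdeg v < D)]
  <-> revenant L N.
Proof.
split=> [idealH t s /lcm_coneP lcm_t tN | revN v w].
  have: val s \in [pred v : 'X_{1..n} |
                    [exists l in N, v \in cone L l] || (mdeg v < D)].
    apply: idealH (lem_mlcmr (val t) (val s)).
    by apply/orP; left; apply/exists_inP; exists t.
  rewrite inE mdeg_terms_deg ltnn orbF => /exists_inP[l lN s_l].
  by have /val_inj-> := cone_mdeg_eq s_l (etrans (mdeg_terms_deg l)
                                            (esym (mdeg_terms_deg s))).
rewrite !inE => /orP Hv le_wv.
case: ltnP => [_|leDw]; first by rewrite orbT.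
(* The degree part of the ideal cannot contain v, as w divides v. *)
have leDv: D <= mdeg v.
  rewrite (leq_trans leDw) // !mdegE; apply: leq_sum => i _.
  exact/mnm_lepP.
case: Hv => [/exists_inP[l lN v_l]|]; last by rewrite ltnNge leDv.
have [u w_u] := cone_deg_ge L leDw.
rewrite orbF; apply/exists_inP; exists u => //.
apply: (revN l) lN; apply/lcm_coneP; apply: (cone_between v_l).
  exact: lem_mlcml.
by rewrite lem_mlcm (cone_lem v_l) (lepm_trans (cone_lem w_u)).
Qed.
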